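(* Let $A=\mathbb{Z}[t^{\pm1},q^{\pm1}]$. The $\mathbf{B}_3$-representations $Bur_3\otimes_{\mathbb{Z}[t^{\pm1}]}A$, $TYM_3\otimes_{\mathbb{Z}[t^{\pm1}]}A$ and $\mathbf{LKB}_3$ are neither subrepresentations nor quotients of $\widetilde{\mathbf{LM}}_q(\eta_3)$. Moreover, the $\mathbf{B}_3$-representations $\overline{Bur}_{3,t}\otimes TYM_{3,q}$, $\overline{Bur}_{3,q}\otimes TYM_{3,t}$, $\overline{Bur}_{3,t}\otimes LKB_{3,t,q}$ and $\overline{Bur}_{3,q}\otimes LKB_{3,t,q}$ (tensor products over $A$) are not isomorphic to $\widetilde{\mathbf{LM}}_q(\eta_3)$.
   Context: $\mathbf{B}_3=\langle\sigma_1,\sigma_2\mid\sigma_1\sigma_2\sigma_1=\sigma_2\sigma_1\sigma_2\rangle$. All representations are over $A=\mathbb{Z}[t^{\pm1},q^{\pm1}]$ (after extension of scalars where indicated). $\widetilde{\mathbf{LM}}_q(\eta_3)\colon\mathbf{B}_3\to\mathrm{GL}_6(A)$ is given by $$\sigma_1\mapsto\begin{pmatrix}0&-q^2&0&0&0&0\\ -q^2t^2&0&0&0&0&0\\ 0&0&-q^2&0&0&0\\ 0&1&0&0&1&0\\ t&0&0&t&0&0\\ 0&0&1&0&0&1\end{pmatrix},\quad\sigma_2\mapsto\begin{pmatrix}1&0&0&q^2&0&0\\ 0&0&1&0&0&q^2\\ 0&t&0&0&q^2t^2&0\\ 0&0&0&-q^2&0&0\\ 0&0&0&0&0&-q^2\\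 0&0&0&0&-q^2t^2&0\end{pmatrix}.$$ $Bur_3\colon\mathbf{B}_3\to\mathrm{GL}_3(\mathbb{Z}[t^{\pm1}])$ is the unreduced Burau representation $\sigma_i\mapsto I_{i-1}\oplus\begin{pmatrix}0&t\\ 1&1-t\end{pmatrix}\oplus I_{2-i}$, and $TYM_3\colon\mathbf{B}_3\to\mathrm{GL}_3(\mathbb{Z}[t^{\pm1}])$ is $\sigma_i\mapsto I_{i-1}\oplus\begin{pmatrix}0&1\\ t&0\end{pmatrix}\oplus I_{2-i}$. $TYM_{3,t}$: $\sigma_1\mapsto\begin{pmatrix}0&1&0\\ t&0&0\\ 0&0&1\end{pmatrix}$, $\sigma_2\mapsto\begin{pmatrix}1&0&0\\ 0&0&t\\ 0&1&0\end{pmatrix}$. $\overline{Bur}_{3,t}$ (reduced Burau): $\sigma_1\mapsto\begin{pmatrix}-t&1\\ 0&1\end{pmatrix}$, $\sigma_2\mapsto\begin{pmatrix}1&0\\ t&-t\end{pmatrix}$. $TYM_{3,q}$ and $\overline{Bur}_{3,q}$ are obtained from these by replacing $t$ by $q$. $\mathbf{LKB}_3=LKB_{3,t,q}$ (Lawrence-Krammer-Bigelow representation): $\sigma_1\mapsto\begin{pmatrix}-q^2t&q(1-q)t&0\\ 0&0&q\\ 0&1&1-q\end{pmatrix}$, $\sigma_2\mapsto\begin{pmatrix}1-q&1&0\\ q&0&0\\ 0&q(1-q)t&-q^2t\end{pmatrix}$. *)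

(* Defs.v *)
From HB Require Import structures.
From mathcomp Require Import all_boot all_order all_algebra.
From mathcomp Require Import generic_quotient ring.
From mathcomp Require Import boolp mxtens.

Set Implicit Arguments.
Unset Strict Implicit.
Unset Printing Implicit Defensive.

Import GRing.Theory.
Local Open Scope ring_scope.
Local Open Scope quotient_scope.

(** [laurent R] is [R['X, 'X^-1]], realised inside the fraction field of
    [{poly R}] as the fractions that become polynomials after multiplication
    by a power of ['X]. *)

Section Laurent.
Variable R : idomainType.
Implicit Types p : {poly R}.

Definition laurent_pred : {pred {fraction {poly R}}} :=
  fun x => `[< exists (n : nat) (p : {poly R}),
                 x * tofrac ('X^n : {poly R}) = tofrac p >].

Lemma laurent_predP x :
  reflect (exists (n : nat) (p : {poly R}),
             x * tofrac ('X^n : {poly R}) = tofrac p)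
          (x \in laurent_pred).
Proof. exact: asboolP. Qed.

Lemma laurent_subring_closed : subring_closed laurent_pred.
Proof.
split=> [|x y /laurent_predP[m [p xp]] /laurent_predP[n [r yr]]
         |x y /laurent_predP[m [p xp]] /laurent_predP[n [r yr]]].
- by apply/laurent_predP; exists 0, 1; rewrite expr0 mul1r.
- apply/laurent_predP; exists (m + n)%N, (p * 'X^n - r * 'X^m).
  by rewrite exprD !(tofracB, tofracM) -xp -yr; ring.
- apply/laurent_predP; exists (m + n)%N, (p * r).
  by rewrite exprD !tofracM -xp -yr; ring.
Qed.

HB.instance Definition _ := GRing.isSubringClosed.Build
  {fraction {poly R}} laurent_pred laurent_subring_closed.

Record laurent := Laurent {
  laurent_val :> {fraction {poly R}};
  _ : laurent_val \in laurent_pred }.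

HB.instance Definition _ := [isSub for laurent_val].
HB.instance Definition _ := [Choice of laurent by <:].
HB.instance Definition _ := [SubChoice_isSubComNzRing of laurent by <:].

Definition laurent_unit : {pred laurent} :=
  fun x => (laurent_val x != 0) && ((laurent_val x)^-1 \in laurent_pred).

Definition laurent_inv (x : laurent) : laurent :=
  if x \in laurent_unit then insubd x (laurent_val x)^-1 else x.

Lemma laurent_valM (x y : laurent) :
  laurent_val (x * y) = laurent_val x * laurent_val y.
Proof. exact: (rmorphM (val : laurent -> _)). Qed.

Lemma laurent_val1 : laurent_val 1 = 1.
Proof. exact: (rmorph1 (val : laurent -> _)). Qed.

Lemma laurent_val0 : laurent_val 0 = 0.
Proof. exact: (raddf0 (val : laurent -> _)). Qed.

Lemma laurent_valB (x y : laurent) :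
  laurent_val (x - y) = laurent_val x - laurent_val y.
Proof. exact: (raddfB (val : laurent -> _)). Qed.

Lemma laurent_mulVx : {in laurent_unit, left_inverse 1 laurent_inv *%R}.
Proof.
move=> x Ux; have /andP[x0 xV] := Ux; apply: val_inj.
rewrite -[LHS]/(laurent_val _) -[RHS]/(laurent_val _) laurent_valM laurent_val1.
rewrite /laurent_inv Ux -[X in X * _]/(val _).
by rewrite insubdK // mulVf.
Qed.

Lemma laurent_unitPl (x y : laurent) : y * x = 1 -> x \in laurent_unit.
Proof.
move=> /(congr1 laurent_val); rewrite laurent_valM laurent_val1 => yx.
have x0 : laurent_val x != 0.
  by apply: contra_eq_neq yx => ->; rewrite mulr0 eq_sym oner_neq0.
apply/andP; split=> //.
rewrite -[_^-1]mul1r -yx mulfK //; exact: (valP y).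
Qed.

Lemma laurent_inv_out : {in [predC laurent_unit], laurent_inv =1 id}.
Proof. by move=> x /negbTE Ux; rewrite /laurent_inv Ux. Qed.

HB.instance Definition _ := GRing.ComNzRing_hasMulInverse.Build laurent
  laurent_mulVx laurent_unitPl laurent_inv_out.

Lemma laurent_idomain_axiom : GRing.integral_domain_axiom laurent.
Proof.
move=> x y /(congr1 laurent_val); rewrite laurent_valM laurent_val0 => /eqP.
by rewrite mulf_eq0 => /orP[] /eqP xy0; apply/orP; [left|right];
  apply/eqP/val_inj; rewrite -[LHS]/(laurent_val _) xy0 -laurent_val0.
Qed.

HB.instance Definition _ :=
  GRing.ComUnitRing_isIntegral.Build laurent laurent_idomain_axiom.

Lemma laurent_poly_subproof p : tofrac p \in laurent_pred.
Proof. by apply/laurent_predP; exists 0, p; rewrite expr0 mulr1. Qed.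

Definition laurent_poly p : laurent := Laurent (laurent_poly_subproof p).

Definition laurent_const (c : R) : laurent := laurent_poly c%:P.

Definition laurent_var : laurent := laurent_poly 'X.

Lemma laurent_const_zmod_morphism : zmod_morphism laurent_const.
Proof.
move=> c d; apply: val_inj; rewrite -[RHS]/(laurent_val _) laurent_valB /=.
by rewrite polyCB tofracB.
Qed.

Lemma laurent_const_monoid_morphism : monoid_morphism laurent_const.
Proof.
split=> [|c d]; apply: val_inj; rewrite -[RHS]/(laurent_val _).
  by rewrite laurent_val1 /= polyC1 tofrac1.
by rewrite laurent_valM /= polyCM tofracM.
Qed.

HB.instance Definition _ := GRing.isZmodMorphism.Build R laurent
  laurent_const laurent_const_zmod_morphism.
HB.instance Definition _ := GRing.isMonoidMorphism.Build R laurent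
  laurent_const laurent_const_monoid_morphism.

Lemma laurent_var_unit : laurent_var \is a GRing.unit.
Proof.
have X0 : tofrac ('X : {poly R}) != 0 by rewrite tofrac_eq0 polyX_eq0.
apply/andP; split=> //; apply/laurent_predP; exists 1%N, 1.
by rewrite expr1 mulVf // rmorph1.
Qed.

End Laurent.

(** [Zt] is [Z[t^{+-1}]]; [A] is [Zt[q^{+-1}] = Z[t^{+-1}, q^{+-1}]], and
    [Zt_to_A] is the inclusion. *)

Definition Zt : idomainType := laurent int.
Definition A : idomainType := laurent Zt.
Definition Zt_to_A : {rmorphism Zt -> A} := @laurent_const Zt.

Definition t0 : Zt := laurent_var int.
Definition t : A := Zt_to_A t0.
Definition q : A := laurent_var Zt.

Lemma t0_unit : t0 \is a GRing.unit. Proof. exact: laurent_var_unit. Qed.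
Lemma t_unit : t \is a GRing.unit. Proof. exact: rmorph_unit t0_unit. Qed.
Lemma q_unit : q \is a GRing.unit. Proof. exact: laurent_var_unit. Qed.

Section Presentation.
Variables (X : choiceType).

(** The letter [(x, false)] stands for the generator [x] and [(x, true)] for
    its inverse. *)
Definition word := seq (X * bool).

Variable rel : word -> word -> Prop.

Inductive word_eqv : word -> word -> Prop :=
| Weqv_refl u : word_eqv u u
| Weqv_sym u v : word_eqv u v -> word_eqv v u
| Weqv_trans v u w : word_eqv u v -> word_eqv v w -> word_eqv u w
| Weqv_cat u u' v v' :
    word_eqv u u' -> word_eqv v v' -> word_eqv (u ++ v) (u' ++ v')
| Weqv_cancel x b : word_eqv [:: (x, b); (x, ~~ b)] [::]
| Weqv_rel u v : rel u v -> word_eqv u v.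

Definition word_eqvb (u v : word) : bool := `[< word_eqv u v >].

Lemma word_eqvb_equiv : equiv_class_of word_eqvb.
Proof.
split=> [u|u v|v u w]; first exact/asboolP/Weqv_refl.
- by apply/asboolP/asboolP; apply: Weqv_sym.
- move=> /asboolP uv /asboolP vw; exact/asboolP/(Weqv_trans uv vw).
Qed.

Canonical word_eqvb_equiv_rel := EquivRelPack word_eqvb_equiv.

Definition presented_group := {eq_quot word_eqvb}.
HB.instance Definition _ := Choice.on presented_group.
HB.instance Definition _ : EqQuotient _ word_eqvb presented_group :=
  EqQuotient.on presented_group.

Definition pclass (u : word) : presented_group := \pi u.

Lemma pclassP u v : pclass u = pclass v <-> word_eqv u v.
Proof. by split=> [/eqmodP/asboolP //|uv]; apply/eqmodP/asboolP. Qed.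

Lemma repr_eqv u : word_eqv (repr (pclass u)) u.
Proof. by apply/pclassP; rewrite /pclass reprK. Qed.

Definition winv (u : word) : word := rev [seq (l.1, ~~ l.2) | l <- u].

Lemma winvl u : word_eqv (winv u ++ u) [::].
Proof.
elim: u => [|[x b] u IH]; first exact: Weqv_refl.
rewrite /winv /= rev_cons cat_rcons -/(winv u).
apply: Weqv_trans IH; apply: Weqv_cat; first exact: Weqv_refl.
rewrite -[X in word_eqv _ X]cat0s -(cat1s (x, b)) -cat1s catA.
apply: Weqv_cat (Weqv_refl _).
by have := Weqv_cancel x (~~ b); rewrite negbK.
Qed.

Lemma winvK : involutive winv.
Proof.
move=> u; rewrite /winv map_rev revK -map_comp map_id_in // => -[x b] _ /=.
by rewrite negbK.
Qed.

Lemma winvr u : word_eqv (u ++ winv u) [::].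
Proof. by rewrite -{1}[u]winvK; exact: winvl. Qed.

Lemma winv_eqv u v : word_eqv u v -> word_eqv (winv u) (winv v).
Proof.
move=> uv; apply: (@Weqv_trans (winv u ++ (v ++ winv v))).
  rewrite -[X in word_eqv X _]cats0.
  by apply: Weqv_cat; [exact: Weqv_refl | exact/Weqv_sym/winvr].
rewrite catA -[X in word_eqv _ X]cat0s.
apply: Weqv_cat; last exact: Weqv_refl.
apply: Weqv_trans (winvl u).
by apply: Weqv_cat; [exact: Weqv_refl | exact: Weqv_sym].
Qed.

Definition pone : presented_group := pclass [::].
Definition pmul (g h : presented_group) : presented_group :=
  pclass (repr g ++ repr h).
Definition pinv (g : presented_group) : presented_group :=
  pclass (winv (repr g)).

Lemma pmulE u v : pmul (pclass u) (pclass v) = pclass (u ++ v).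
Proof. by apply/pclassP; apply: Weqv_cat; exact: repr_eqv. Qed.

Lemma pinvE u : pinv (pclass u) = pclass (winv u).
Proof. by apply/pclassP/winv_eqv/repr_eqv. Qed.

Lemma pclass_ind (P : presented_group -> Prop) :
  (forall u, P (pclass u)) -> forall g, P g.
Proof. by move=> Pu g; rewrite -[g]reprK; exact: Pu. Qed.

Lemma pmulA : associative pmul.
Proof.
elim/pclass_ind=> u; elim/pclass_ind=> v; elim/pclass_ind=> w.
by rewrite !pmulE catA.
Qed.

Lemma pmul1g : left_id pone pmul.
Proof. by elim/pclass_ind=> u; rewrite /pone pmulE. Qed.

Lemma pmulg1 : right_id pone pmul.
Proof. by elim/pclass_ind=> u; rewrite /pone pmulE cats0. Qed.

Lemma pmulVg : left_inverse pone pinv pmul.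
Proof. by elim/pclass_ind=> u; rewrite pinvE pmulE; exact/pclassP/winvl. Qed.

Lemma pmulgV : right_inverse pone pinv pmul.
Proof. by elim/pclass_ind=> u; rewrite pinvE pmulE; exact/pclassP/winvr. Qed.

HB.instance Definition _ := isGroup.Build presented_group
  pmulA pmul1g pmulg1 pmulVg pmulgV.

Definition pgen (x : X) : presented_group := pclass [:: (x, false)].

End Presentation.

(** The letters [0] and [1] of ['I_2] stand for [sigma_1] and [sigma_2]. *)
Definition B3_rel (u v : word 'I_2) : Prop :=
  u = [:: (0, false); (1, false); (0, false)] /\
  v = [:: (1, false); (0, false); (1, false)].

Definition B3 : groupType := presented_group B3_rel.

Definition sigma1 : B3 := pgen B3_rel 0.
Definition sigma2 : B3 := pgen B3_rel 1.

(** A homomorphism from [B3] to [GL_n(R)]; its values are automatically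
    invertible.  The underlying module is ['cV[R]_n], on which matrices act on
    the left. *)
Record B3_repr (R : comNzRingType) (n : nat) := B3Repr {
  B3_mx :> B3 -> 'M[R]_n;
  B3_mx1 : B3_mx 1%g = 1%:M;
  B3_mxM : forall g h : B3, B3_mx (g * h)%g = B3_mx g *m B3_mx h }.

Definition equivariant (R : comNzRingType) (m n : nat)
    (rho : B3_repr R m) (tau : B3_repr R n) (f : 'cV[R]_m -> 'cV[R]_n) : Prop :=
  forall (g : B3) (v : 'cV[R]_m), f (rho g *m v) = tau g *m f v.

(** The image of such an [f] is an invariant submodule isomorphic to [rho]; it
    need not be a direct summand. *)
Definition is_subrepresentation (R : comNzRingType) (m n : nat)
    (rho : B3_repr R m) (tau : B3_repr R n) : Prop :=
  exists f : {linear 'cV[R]_m -> 'cV[R]_n},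
    injective f /\ equivariant rho tau f.

(** Equivalently, [rho] is isomorphic to the quotient of [tau] by an invariant
    submodule, the kernel of [f]. *)
Definition is_quotient (R : comNzRingType) (m n : nat)
    (rho : B3_repr R m) (tau : B3_repr R n) : Prop :=
  exists f : {linear 'cV[R]_n -> 'cV[R]_m},
    (forall w, exists v, f v = w) /\ equivariant tau rho f.

Definition isomorphic_repr (R : comNzRingType) (m n : nat)
    (rho : B3_repr R m) (tau : B3_repr R n) : Prop :=
  exists f : {linear 'cV[R]_m -> 'cV[R]_n},
    bijective f /\ equivariant rho tau f.

Section ReprConstructions.
Variables (R : comNzRingType) (m n : nat).

Section Tensor.
Variables (rho : B3_repr R m) (tau : B3_repr R n).

Definition tensor_mx (g : B3) : 'M[R]_(m * n) := rho g *t tau g.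

Lemma tensor_mx1 : tensor_mx 1%g = 1%:M.
Proof.
rewrite /tensor_mx !B3_mx1; apply/matrixP => i j.
case: (mxtens_indexP i) => i1 i2; case: (mxtens_indexP j) => j1 j2.
by rewrite tensmxE !mxE (can_eq (@mxtens_indexK m n)) xpair_eqE -natrM mulnb.
Qed.

Lemma tensor_mxM (g h : B3) : tensor_mx (g * h)%g = tensor_mx g *m tensor_mx h.
Proof. by rewrite /tensor_mx !B3_mxM tensmx_mul. Qed.

(** The tensor product over [R], in the Kronecker basis. *)
Definition tensor_repr : B3_repr R (m * n) := B3Repr tensor_mx1 tensor_mxM.

End Tensor.

Section BaseChange.
Variables (S : comNzRingType) (f : {rmorphism R -> S}) (rho : B3_repr R n).

Lemma base_change_mx1 : map_mx f (rho 1%g) = 1%:M.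
Proof. by rewrite B3_mx1 map_mx1. Qed.

Lemma base_change_mxM (g h : B3) :
  map_mx f (rho (g * h)%g) = map_mx f (rho g) *m map_mx f (rho h).
Proof. by rewrite B3_mxM map_mxM. Qed.

Definition base_change : B3_repr S n :=
  B3Repr base_change_mx1 base_change_mxM.

End BaseChange.
End ReprConstructions.

Section ReprOfGens.
Variables (R : comUnitRingType) (n : nat) (S1 S2 : 'M[R]_n).

Definition letter_mx (l : 'I_2 * bool) : 'M[R]_n :=
  let S := if l.1 == 0 then S1 else S2 in if l.2 then invmx S else S.

Definition word_mx (u : word 'I_2) : 'M[R]_n :=
  foldr (fun l M => letter_mx l *m M) 1%:M u.

Hypotheses (U1 : S1 \in unitmx) (U2 : S2 \in unitmx).
Hypothesis braid : S1 *m S2 *m S1 = S2 *m S1 *m S2.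

Lemma word_mx_cat u v : word_mx (u ++ v) = word_mx u *m word_mx v.
Proof. by elim: u => [|l u IH] /=; rewrite ?mul1mx // IH mulmxA. Qed.

Lemma word_mx_eqv u v : word_eqv B3_rel u v -> word_mx u = word_mx v.
Proof.
elim=> {u v} [u|u v _ <-|v u w _ -> _ <-|u u' v v' _ IHu _ IHv|x b|u v [-> ->]] //.
- by rewrite !word_mx_cat IHu IHv.
- rewrite /word_mx /= /letter_mx mulmx1 /=.
  by case: b; case: eqP => _ /=; rewrite ?mulVmx ?mulmxV.
- by rewrite /= /letter_mx /= !mulmx1 !mulmxA.
Qed.

Definition gens_mx (g : B3) : 'M[R]_n := word_mx (repr g).

Lemma gens_mxE u : gens_mx (pclass B3_rel u) = word_mx u.
Proof. exact/word_mx_eqv/repr_eqv. Qed.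

Lemma gens_mx1 : gens_mx 1%g = 1%:M.
Proof. exact: (gens_mxE [::]). Qed.

Lemma gens_mxM (g h : B3) : gens_mx (g * h)%g = gens_mx g *m gens_mx h.
Proof. by rewrite gens_mxE word_mx_cat. Qed.

Definition repr_of_gens : B3_repr R n := B3Repr gens_mx1 gens_mxM.

Lemma repr_of_gens_sigma1 : repr_of_gens sigma1 = S1.
Proof. by rewrite /= gens_mxE /= mulmx1. Qed.

Lemma repr_of_gens_sigma2 : repr_of_gens sigma2 = S2.
Proof. by rewrite /= gens_mxE /= mulmx1. Qed.

End ReprOfGens.

Definition mx_of_rows (R : nmodType) (n : nat) (rows : seq (seq R)) : 'M[R]_n :=
  \matrix_(i, j) nth 0 (nth [::] rows i) j.

Definition rows_mul (R : pzRingType) (n : nat) (a b : seq (seq R)) :=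
  mkseq (fun i => mkseq (fun j => foldr +%R 0
    (mkseq (fun k => nth 0 (nth [::] a i) k * nth 0 (nth [::] b k) j) n)) n) n.

Lemma mx_of_rowsM (R : pzRingType) (n : nat) (a b : seq (seq R)) :
  mx_of_rows n a *m mx_of_rows n b = mx_of_rows n (rows_mul n a b).
Proof.
apply/matrixP => i j; rewrite !mxE !nth_mkseq // foldrE big_map.
rewrite -val_enum_ord big_map big_enum /=.
by apply: eq_bigr => k _; rewrite !mxE.
Qed.

Lemma mx_of_rows_unit (R : comUnitRingType) (n : nat) (a b : seq (seq R)) :
    rows_mul n a b = mkseq (fun i => mkseq (fun j => (i == j)%:R) n) n ->
  mx_of_rows n a \in unitmx.
Proof.
move=> ab1; have /mulmx1_unit[] // : mx_of_rows n a *m mx_of_rows n b = 1%:M.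
by rewrite mx_of_rowsM ab1; apply/matrixP => i j; rewrite !mxE !nth_mkseq.
Qed.

Ltac rows_eq tac :=
  rewrite /rows_mul /mkseq /=;
  repeat (congr cons); rewrite ?addr0; tac.

Section Matrices.
Variable R : comUnitRingType.
Variables t q : R.

Definition LM_1 : 'M[R]_6 := mx_of_rows 6
  [:: [:: 0;                 - q ^+ 2; 0;        0; 0; 0];
      [:: - (q ^+ 2 * t ^+ 2); 0;      0;        0; 0; 0];
      [:: 0;                 0;        - q ^+ 2; 0; 0; 0];
      [:: 0;                 1;        0;        0; 1; 0];
      [:: t;                 0;        0;        t; 0; 0];
      [:: 0;                 0;        1;        0; 0; 1]].

Definition LM_2 : 'M[R]_6 := mx_of_rows 6
  [:: [:: 1; 0; 0; q ^+ 2;   0;                   0];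
      [:: 0; 0; 1; 0;        0;                   q ^+ 2];
      [:: 0; t; 0; 0;        q ^+ 2 * t ^+ 2;     0];
      [:: 0; 0; 0; - q ^+ 2; 0;                   0];
      [:: 0; 0; 0; 0;        0;                   - q ^+ 2];
      [:: 0; 0; 0; 0;        - (q ^+ 2 * t ^+ 2); 0]].

Definition Bur_1 : 'M[R]_3 := mx_of_rows 3
  [:: [:: 0; t;     0];
      [:: 1; 1 - t; 0];
      [:: 0; 0;     1]].

Definition Bur_2 : 'M[R]_3 := mx_of_rows 3
  [:: [:: 1; 0; 0];
      [:: 0; 0; t];
      [:: 0; 1; 1 - t]].

(** [TYM_3] is [TYM_1], [TYM_2] and [TYM_{3,t}] is [TYM_1], [TYMv_2]: the two
    differ by which of [e_2], [e_3] carries the factor [t] under [sigma2]. *)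
Definition TYM_1 : 'M[R]_3 := mx_of_rows 3
  [:: [:: 0; 1; 0];
      [:: t; 0; 0];
      [:: 0; 0; 1]].

Definition TYM_2 : 'M[R]_3 := mx_of_rows 3
  [:: [:: 1; 0; 0];
      [:: 0; 0; 1];
      [:: 0; t; 0]].

Definition TYMv_2 : 'M[R]_3 := mx_of_rows 3
  [:: [:: 1; 0; 0];
      [:: 0; 0; t];
      [:: 0; 1; 0]].

Definition redBur_1 : 'M[R]_2 := mx_of_rows 2
  [:: [:: - t; 1];
      [:: 0;   1]].

Definition redBur_2 : 'M[R]_2 := mx_of_rows 2
  [:: [:: 1; 0];
      [:: t; - t]].

Definition LKB_1 : 'M[R]_3 := mx_of_rows 3
  [:: [:: - (q ^+ 2 * t); q * (1 - q) * t; 0];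
      [:: 0;              0;               q];
      [:: 0;              1;               1 - q]].

Definition LKB_2 : 'M[R]_3 := mx_of_rows 3
  [:: [:: 1 - q; 1;               0];
      [:: q;     0;               0];
      [:: 0;     q * (1 - q) * t; - (q ^+ 2 * t)]].

Lemma LM_braid : LM_1 *m LM_2 *m LM_1 = LM_2 *m LM_1 *m LM_2.
Proof. rewrite /LM_1 /LM_2 !mx_of_rowsM; congr mx_of_rows; rows_eq ltac:(ring). Qed.

Lemma Bur_braid : Bur_1 *m Bur_2 *m Bur_1 = Bur_2 *m Bur_1 *m Bur_2.
Proof. rewrite /Bur_1 /Bur_2 !mx_of_rowsM; congr mx_of_rows; rows_eq ltac:(ring). Qed.

Lemma TYM_braid : TYM_1 *m TYM_2 *m TYM_1 = TYM_2 *m TYM_1 *m TYM_2.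
Proof. rewrite /TYM_1 /TYM_2 !mx_of_rowsM; congr mx_of_rows; rows_eq ltac:(ring). Qed.

Lemma TYMv_braid : TYM_1 *m TYMv_2 *m TYM_1 = TYMv_2 *m TYM_1 *m TYMv_2.
Proof. rewrite /TYM_1 /TYMv_2 !mx_of_rowsM; congr mx_of_rows; rows_eq ltac:(ring). Qed.

Lemma redBur_braid :
  redBur_1 *m redBur_2 *m redBur_1 = redBur_2 *m redBur_1 *m redBur_2.
Proof. rewrite /redBur_1 /redBur_2 !mx_of_rowsM; congr mx_of_rows; rows_eq ltac:(ring). Qed.

Lemma LKB_braid : LKB_1 *m LKB_2 *m LKB_1 = LKB_2 *m LKB_1 *m LKB_2.
Proof. rewrite /LKB_1 /LKB_2 !mx_of_rowsM; congr mx_of_rows; rows_eq ltac:(ring). Qed.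

Hypothesis Ut : t \is a GRing.unit.

Let tt : t * t^-1 = 1. Proof. exact: mulrV. Qed.

Lemma Bur_1_unit : Bur_1 \in unitmx.
Proof.
apply: (@mx_of_rows_unit _ _ _
  [:: [:: 1 - t^-1; 1; 0]; [:: t^-1; 0; 0]; [:: 0; 0; 1]]).
rows_eq ltac:(ring: tt).
Qed.

Lemma Bur_2_unit : Bur_2 \in unitmx.
Proof.
apply: (@mx_of_rows_unit _ _ _
  [:: [:: 1; 0; 0]; [:: 0; 1 - t^-1; 1]; [:: 0; t^-1; 0]]).
rows_eq ltac:(ring: tt).
Qed.

Lemma TYM_1_unit : TYM_1 \in unitmx.
Proof.
apply: (@mx_of_rows_unit _ _ _
  [:: [:: 0; t^-1; 0]; [:: 1; 0; 0]; [:: 0; 0; 1]]).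
rows_eq ltac:(ring: tt).
Qed.

Lemma TYM_2_unit : TYM_2 \in unitmx.
Proof.
apply: (@mx_of_rows_unit _ _ _
  [:: [:: 1; 0; 0]; [:: 0; 0; t^-1]; [:: 0; 1; 0]]).
rows_eq ltac:(ring: tt).
Qed.

Lemma TYMv_2_unit : TYMv_2 \in unitmx.
Proof.
apply: (@mx_of_rows_unit _ _ _
  [:: [:: 1; 0; 0]; [:: 0; 0; 1]; [:: 0; t^-1; 0]]).
rows_eq ltac:(ring: tt).
Qed.

Lemma redBur_1_unit : redBur_1 \in unitmx.
Proof.
apply: (@mx_of_rows_unit _ _ _ [:: [:: - t^-1; t^-1]; [:: 0; 1]]).
rows_eq ltac:(ring: tt).
Qed.

Lemma redBur_2_unit : redBur_2 \in unitmx.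
Proof.
apply: (@mx_of_rows_unit _ _ _ [:: [:: 1; 0]; [:: 1; - t^-1]]).
rows_eq ltac:(ring: tt).
Qed.

Hypothesis Uq : q \is a GRing.unit.

Let qq : q * q^-1 = 1. Proof. exact: mulrV. Qed.

Lemma LKB_1_unit : LKB_1 \in unitmx.
Proof.
apply: (@mx_of_rows_unit _ _ _
  [:: [:: - (q^-1 ^+ 2 * t^-1); - ((1 - q) ^+ 2 * q^-1 ^+ 2); (1 - q) * q^-1];
      [:: 0; (q - 1) * q^-1; 1];
      [:: 0; q^-1; 0]]).
rows_eq ltac:(ring: tt qq).
Qed.

Lemma LKB_2_unit : LKB_2 \in unitmx.
Proof.
apply: (@mx_of_rows_unit _ _ _
  [:: [:: 0; q^-1; 0];
      [:: 1; (q - 1) * q^-1; 0];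
      [:: (1 - q) * q^-1; - ((1 - q) ^+ 2 * q^-1 ^+ 2); - (q^-1 ^+ 2 * t^-1)]]).
rows_eq ltac:(ring: tt qq).
Qed.

Lemma LM_1_unit : LM_1 \in unitmx.
Proof.
apply: (@mx_of_rows_unit _ _ _
  [:: [:: 0; - (q^-1 ^+ 2 * t^-1 ^+ 2); 0; 0; 0; 0];
      [:: - q^-1 ^+ 2; 0; 0; 0; 0; 0];
      [:: 0; 0; - q^-1 ^+ 2; 0; 0; 0];
      [:: 0; q^-1 ^+ 2 * t^-1 ^+ 2; 0; 0; t^-1; 0];
      [:: q^-1 ^+ 2; 0; 0; 1; 0; 0];
      [:: 0; 0; q^-1 ^+ 2; 0; 0; 1]]).
rows_eq ltac:(ring: tt qq).
Qed.

Lemma LM_2_unit : LM_2 \in unitmx.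
Proof.
apply: (@mx_of_rows_unit _ _ _
  [:: [:: 1; 0; 0; 1; 0; 0];
      [:: 0; 0; t^-1; 0; 0; t^-1];
      [:: 0; 1; 0; 0; 1; 0];
      [:: 0; 0; 0; - q^-1 ^+ 2; 0; 0];
      [:: 0; 0; 0; 0; 0; - (q^-1 ^+ 2 * t^-1 ^+ 2)];
      [:: 0; 0; 0; 0; - q^-1 ^+ 2; 0]]).
rows_eq ltac:(ring: tt qq).
Qed.

Definition LM_repr : B3_repr R 6 := repr_of_gens LM_1_unit LM_2_unit LM_braid.

Definition Bur_repr : B3_repr R 3 :=
  repr_of_gens Bur_1_unit Bur_2_unit Bur_braid.

Definition TYM_repr : B3_repr R 3 :=
  repr_of_gens TYM_1_unit TYM_2_unit TYM_braid.

Definition TYMv_repr : B3_repr R 3 :=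
  repr_of_gens TYM_1_unit TYMv_2_unit TYMv_braid.

Definition redBur_repr : B3_repr R 2 :=
  repr_of_gens redBur_1_unit redBur_2_unit redBur_braid.

Definition LKB_repr : B3_repr R 3 :=
  repr_of_gens LKB_1_unit LKB_2_unit LKB_braid.

End Matrices.

Definition LM_eta3 : B3_repr A 6 := LM_repr t_unit q_unit.
Definition Bur3 : B3_repr Zt 3 := Bur_repr t0_unit.
Definition TYM3 : B3_repr Zt 3 := TYM_repr t0_unit.
Definition TYM3_t : B3_repr A 3 := TYMv_repr t_unit.
Definition TYM3_q : B3_repr A 3 := TYMv_repr q_unit.
Definition redBur3_t : B3_repr A 2 := redBur_repr t_unit.
Definition redBur3_q : B3_repr A 2 := redBur_repr q_unit.
Definition LKB3 : B3_repr A 3 := LKB_repr t_unit q_unit.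

(* Main.v *)
(** On [LM_eta3] the eigenvalues of [sigma1] are [q^2 t], [- q^2 t], [- q^2],
    [1] and the two square roots of [t].  Every other representation except
    [TYM_3] has [- t] or [- q] as an eigenvalue of [sigma1], and an injective
    (resp. surjective) intertwiner transports a right (resp. left) eigenvector.
    The eigenvalues of [TYM_3] do occur in [LM_eta3]; there the fixed vectors
    of [sigma1] and [sigma2] pin an intertwiner down to two scalars, and the
    remaining relation between them forces the image of [e_1] (resp. the
    pullback of the first coordinate form) to vanish, as [1 - q^2 t]
    (resp. [1 - q^6 t]) is nonzero. *)

Require Import Defs.
From HB Require Import structures.
From mathcomp Require Import all_boot all_algebra.
From mathcomp Require Import ring mxtens.

Set Implicit Arguments.
Unset Strict Implicit.
Unset Printing Implicit Defensive.

Import GRing.Theory.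
Local Open Scope ring_scope.

(** * Nonvanishing in [A] by evaluation at an integer point *)

Section LaurentPoly.
Variable R : idomainType.

Lemma laurent_poly_zmod_morphism : zmod_morphism (@laurent_poly R).
Proof.
move=> p r; apply: val_inj; rewrite -[RHS]/(laurent_val _) laurent_valB /=.
by rewrite tofracB.
Qed.

Lemma laurent_poly_monoid_morphism : monoid_morphism (@laurent_poly R).
Proof.
split=> [|p r]; apply: val_inj; rewrite -[RHS]/(laurent_val _).
  by rewrite laurent_val1 /= tofrac1.
by rewrite laurent_valM /= tofracM.
Qed.

HB.instance Definition _ := GRing.isZmodMorphism.Build {poly R} (laurent R)
  (@laurent_poly R) laurent_poly_zmod_morphism.
HB.instance Definition _ := GRing.isMonoidMorphism.Build {poly R} (laurent R)
  (@laurent_poly R) laurent_poly_monoid_morphism.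

Lemma laurent_poly_inj : injective (@laurent_poly R).
Proof. by move=> p r [] /eqP; rewrite tofrac_eq => /eqP. Qed.

End LaurentPoly.

Definition A_poly : {rmorphism {poly {poly int}} -> A} :=
  @laurent_poly Zt \o map_poly (@laurent_poly int).

Local Notation T := ('X%:P : {poly {poly int}}).
Local Notation Q := ('X : {poly {poly int}}).

Lemma A_polyX : A_poly Q = q.
Proof. by rewrite /= map_polyX. Qed.

Lemma A_polyC : A_poly T = t.
Proof. by rewrite /= map_polyC. Qed.

(** Both embeddings composed in [A_poly] are injective, so one nonzero integer value is a
    certificate. The outer variable is [q] and the inner one [t]: the point is q = 2, t = 3, at
    which none of the polynomials met below vanishes. *)
Lemma A_poly_neq0 (p : {poly {poly int}}) : p.[2].[3] != 0 -> A_poly p != 0.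
Proof.
apply: contraNneq => pA0.
have /laurent_poly_inj : A_poly p = A_poly 0 by rewrite rmorph0.
by move=> /(map_inj_poly (@laurent_poly_inj int) (rmorph0 _)) ->; rewrite !horner0.
Qed.

(* Here [p] is a polynomial lift of the element in the goal: the first branch evaluates it, the
   second identifies [A_poly p] with that element. *)
Tactic Notation "A_neq0" uconstr(p) :=
  refine (eq_ind _ (fun x => x != 0) (@A_poly_neq0 p _) _ _);
  [ by rewrite !(hornerE, hornerXn)
  | by rewrite ?(rmorphD, rmorphN, rmorphXn, rmorphM, rmorph1) ?(A_polyX, A_polyC)].

(** * Vectors as lists of coordinates *)

Section Coordinates.
Variables (R : comNzRingType) (n : nat).
Implicit Types (s : seq R) (a : seq (seq R)).

(** With lists, an equation between concrete vectors splits by injection into one scalar equation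
    per coordinate. *)
Definition col_of s : 'cV[R]_n := \col_i s`_i.
Definition row_of s : 'rV[R]_n := \row_i s`_i.

Lemma col_ofP (v : 'cV[R]_n) : exists2 s, size s = n & v = col_of s.
Proof.
exists (codom (v^~ 0)); first by rewrite size_codom card_ord.
apply/colP => i; rewrite mxE (nth_map i) ?size_enum_ord //.
by rewrite nth_ord_enum.
Qed.

Lemma row_ofP (u : 'rV[R]_n) : exists2 s, size s = n & u = row_of s.
Proof.
exists (codom (u 0)); first by rewrite size_codom card_ord.
apply/rowP => i; rewrite mxE (nth_map i) ?size_enum_ord //.
by rewrite nth_ord_enum.
Qed.

Lemma col_of_inj s s' :
  col_of s = col_of s' -> size s = n -> size s' = n -> s = s'.
Proof.
move=> /colP ss' sn s'n; apply: (@eq_from_nth _ 0) => [|i]; rewrite sn ?s'n //.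
by move=> ilt; have := ss' (Ordinal ilt); rewrite !mxE.
Qed.

Lemma row_of_inj s s' :
  row_of s = row_of s' -> size s = n -> size s' = n -> s = s'.
Proof.
move=> /rowP ss' sn s'n; apply: (@eq_from_nth _ 0) => [|i]; rewrite sn ?s'n //.
by move=> ilt; have := ss' (Ordinal ilt); rewrite !mxE.
Qed.

Lemma nth0_map_mul c s i : [seq c * x | x <- s]`_i = c * s`_i.
Proof.
have [ilt | ige] := ltnP i (size s); first by rewrite (nth_map 0).
by rewrite !nth_default ?size_map // mulr0.
Qed.

Lemma scale_col_of c s : c *: col_of s = col_of [seq c * x | x <- s].
Proof. by apply/colP => i; rewrite !mxE nth0_map_mul. Qed.

Lemma scale_row_of c s : c *: row_of s = row_of [seq c * x | x <- s].
Proof. by apply/rowP => i; rewrite !mxE nth0_map_mul. Qed.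

(** The right-hand side unfolds to an explicit sum by computation once [n] is a numeral. *)
Lemma sum_ord_mkseq (F : nat -> R) :
  \sum_(i < n) F i = foldr +%R 0 (mkseq F n).
Proof. by rewrite foldrE big_map -val_enum_ord big_map big_enum. Qed.

Lemma mul_mx_col_of a s : mx_of_rows n a *m col_of s =
  col_of (mkseq (fun i => foldr +%R 0
    (mkseq (fun k => (nth [::] a i)`_k * s`_k) n)) n).
Proof.
apply/colP => i; rewrite !mxE nth_mkseq // -sum_ord_mkseq.
by apply: eq_bigr => k _; rewrite !mxE.
Qed.

Lemma mul_row_of_mx a s : row_of s *m mx_of_rows n a =
  row_of (mkseq (fun j => foldr +%R 0
    (mkseq (fun k => s`_k * (nth [::] a k)`_j) n)) n).
Proof.
apply/rowP => j; rewrite !mxE nth_mkseq // -sum_ord_mkseq.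
by apply: eq_bigr => k _; rewrite !mxE.
Qed.

End Coordinates.

(** * Intertwiners as matrices, and transport of eigenvectors *)

Section Intertwiners.
Variables (R : comNzRingType) (m n : nat).
Variables (rho : B3_repr R m) (tau : B3_repr R n).

Lemma linear_col_mx (k l : nat) (f : {linear 'cV[R]_k -> 'cV[R]_l}) :
  exists F : 'M[R]_(l, k), forall v, f v = F *m v.
Proof.
exists (\matrix_(i, j) f (delta_mx j 0) i 0) => v.
rewrite {1}[v]matrix_sum_delta linear_sum; apply/colP => i.
rewrite summxE mxE; apply: eq_bigr => j _.
by rewrite big_ord1 linearZ !mxE mulrC.
Qed.

Lemma eq_mulmx_col (k l : nat) (M N : 'M[R]_(k, l)) :
  (forall v : 'cV_l, M *m v = N *m v) -> M = N.
Proof.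
move=> MN; apply/matrixP => i j.
by have /colP/(_ i) := MN (delta_mx j 0); rewrite -!colE !mxE.
Qed.

Lemma subrepresentation_mx : is_subrepresentation rho tau ->
  exists2 F : 'M[R]_(n, m), forall g, F *m rho g = tau g *m F &
    forall v : 'cV_m, F *m v = 0 -> v = 0.
Proof.
case=> f [f_inj f_eqv]; have [F fE] := linear_col_mx f; exists F => [g|v Fv0].
  by apply: eq_mulmx_col => v; rewrite -!mulmxA -!fE.
by apply: f_inj; rewrite !fE Fv0 mulmx0.
Qed.

Lemma quotient_mx : is_quotient rho tau ->
  exists2 F : 'M[R]_(m, n), forall g, rho g *m F = F *m tau g &
    forall u : 'rV_m, u *m F = 0 -> u = 0.
Proof.
case=> f [f_surj f_eqv]; have [F fE] := linear_col_mx f; exists F => [g|u uF0].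
  by apply: eq_mulmx_col => v; rewrite -!mulmxA -!fE.
(* Surjectivity of [f] makes [F] left-cancellable: each basis vector is some [F *m v], so the [j]-th
   entry of [u] is [u *m F *m v], which is zero. *)
apply/rowP => j; have [v fv] := f_surj (delta_mx j 0).
have /rowP/(_ 0) : u *m delta_mx j 0 = (0 : 'rV_1).
  by rewrite -fv fE mulmxA uF0 mul0mx.
by rewrite -colE !mxE.
Qed.

Lemma isomorphic_subrepresentation :
  isomorphic_repr rho tau -> is_subrepresentation rho tau.
Proof. by case=> f [/bij_inj f_inj f_eqv]; exists f. Qed.

Lemma subrepresentation_eigenvector g c (v : 'cV_m) :
    is_subrepresentation rho tau -> rho g *m v = c *: v ->
    (forall w : 'cV_n, tau g *m w = c *: w -> w = 0) ->
  v = 0.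
Proof.
move=> /subrepresentation_mx[F F_eqv F_inj] rv tau0; apply/F_inj/tau0.
by rewrite mulmxA -F_eqv -mulmxA rv scalemxAr.
Qed.

Lemma quotient_eigenvector g c (u : 'rV_m) :
    is_quotient rho tau -> u *m rho g = c *: u ->
    (forall w : 'rV_n, w *m tau g = c *: w -> w = 0) ->
  u = 0.
Proof.
move=> /quotient_mx[F F_eqv F_inj] ru tau0; apply/F_inj/tau0.
by rewrite -mulmxA -F_eqv mulmxA ru scalemxAl.
Qed.

Lemma tensor_eigenvector g a b (v : 'cV_m) (w : 'cV_n) :
    rho g *m v = a *: v -> tau g *m w = b *: w ->
  tensor_repr rho tau g *m (v *t w) = (a * b) *: (v *t w).
Proof.
move=> rv tw; rewrite /= /tensor_mx tensmx_mul rv tw.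
by apply/matrixP => i j; rewrite !mxE; ring.
Qed.

End Intertwiners.

(** A nonzero entry of [v] could be cancelled from its products with the entries of [w], which would
    force [w = 0]. *)
Lemma tensmx_eq0 (R : idomainType) (m n : nat) (v : 'cV[R]_m) (w : 'cV[R]_n) :
  v *t w = 0 -> w != 0 -> v = 0.
Proof.
move=> vw0 /eqP w0; apply/colP => i; rewrite mxE; apply/eqP/negPn/negP => vi.
apply: w0; apply/colP => j; rewrite mxE; apply: (mulfI vi); rewrite mulr0.
have /matrixP/(_ (mxtens_index (i, j)) (mxtens_index (0, 0))) := vw0.
by rewrite tensmxE mxE.
Qed.

(** * Eigenvectors of [sigma1] on the rank-six representation *)

Section LMKernel.
Variable R : idomainType.

(** An elimination step with certificate: the last premise is a polynomial identity left to [ring],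
    and the nonzero pivot [k] is cancelled in the domain. With two equations this is Cramer's
    rule. *)
Lemma lincomb1 (k c l r x : R) : l = r -> k != 0 -> k * x = c * (l - r) -> x = 0.
Proof. by move=> -> k0; rewrite subrr mulr0 -[in RHS](mulr0 k) => /(mulfI k0). Qed.

Lemma lincomb2 (k c1 c2 l1 r1 l2 r2 x : R) : l1 = r1 -> l2 = r2 -> k != 0 ->
  k * x = c1 * (l1 - r1) + c2 * (l2 - r2) -> x = 0.
Proof.
move=> -> -> k0.
by rewrite !subrr !mulr0 addr0 -[in RHS](mulr0 k) => /(mulfI k0).
Qed.

Variables t q c : R.
(** [LM_1] is block lower triangular with blocks on the coordinates {1,2}, {3}, {4,5}, {6}. These
    quantities and [c - 1] are the values at [c] of the characteristic polynomials of the blocks. *)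
Hypotheses (ktq : c ^+ 2 - q ^+ 4 * t ^+ 2 != 0) (kq : c + q ^+ 2 != 0).
Hypothesis kt : c ^+ 2 - t != 0.

(** Forward substitution through the blocks kills all coordinates but the last. The factor [c - 1]
    stays open so that the case [c = 1] describes the fixed vectors. *)
Lemma LM_1_col_eigenvector (w : 'cV[R]_6) : LM_1 t q *m w = c *: w ->
  exists2 f, (c - 1) * f = 0 & w = col_of 6 [:: 0; 0; 0; 0; 0; f].
Proof.
have [[|x1 [|x2 [|x3 [|x4 [|x5 [|x6 []]]]]]] // _ ->] := col_ofP w.
rewrite mul_mx_col_of scale_col_of => /col_of_inj/(_ erefl erefl)[] /=.
move=> e1 e2 e3 e4 e5 e6.
have x10 : x1 = 0.
  by apply: (@lincomb2 _ (- c) (q ^+ 2) _ _ _ _ _ e1 e2 ktq); ring.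
have x20 : x2 = 0.
  by apply: (@lincomb2 _ (- c) (q ^+ 2 * t ^+ 2) _ _ _ _ _ e2 e1 ktq); ring.
have x30 : x3 = 0 by apply: (@lincomb1 _ (- 1) _ _ _ e3 kq); ring.
subst x1 x2 x3.
have x40 : x4 = 0 by apply: (@lincomb2 _ (- c) (- 1) _ _ _ _ _ e4 e5 kt); ring.
have x50 : x5 = 0 by apply: (@lincomb2 _ (- c) (- t) _ _ _ _ _ e5 e4 kt); ring.
subst x4 x5; exists x6 => //.
by rewrite mulrBl -e6; ring.
Qed.

(** For rows the substitution starts from the block {4,5}. The third column of [LM_1] ties the last
    coordinate to the third. *)
Lemma LM_1_row_eigenvector (w : 'rV[R]_6) : w *m LM_1 t q = c *: w ->
  exists2 z, (c - 1) * ((c + q ^+ 2) * z) = 0 &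
    w = row_of 6 [:: 0; 0; z; 0; 0; (c + q ^+ 2) * z].
Proof.
have [[|x1 [|x2 [|x3 [|x4 [|x5 [|x6 []]]]]]] // _ ->] := row_ofP w.
rewrite mul_row_of_mx scale_row_of => /row_of_inj/(_ erefl erefl)[] /=.
move=> e1 e2 e3 e4 e5 e6.
have x40 : x4 = 0 by apply: (@lincomb2 _ (- c) (- t) _ _ _ _ _ e4 e5 kt); ring.
have x50 : x5 = 0 by apply: (@lincomb2 _ (- c) (- 1) _ _ _ _ _ e5 e4 kt); ring.
subst x4 x5.
have x10 : x1 = 0.
  by apply: (@lincomb2 _ (- c) (q ^+ 2 * t ^+ 2) _ _ _ _ _ e1 e2 ktq); ring.
have x20 : x2 = 0 by apply: (@lincomb2 _ (- c) (q ^+ 2) _ _ _ _ _ e2 e1 ktq); ring.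
have x6E : x6 = (c + q ^+ 2) * x3 by rewrite mulrDl -e3; ring.
subst x1 x2 x6; exists x3 => //.
by rewrite mulrBl -e6; ring.
Qed.

Hypothesis k1 : c - 1 != 0.

Lemma LM_1_col_regular (w : 'cV[R]_6) : LM_1 t q *m w = c *: w -> w = 0.
Proof.
move=> /LM_1_col_eigenvector[f]; rewrite -[in RHS](mulr0 (c - 1)).
by move=> /(mulfI k1) -> ->; apply/colP => -[[|[|[|[|[|[|i]]]]]] // ?]; rewrite !mxE.
Qed.

Lemma LM_1_row_regular (w : 'rV[R]_6) : w *m LM_1 t q = c *: w -> w = 0.
Proof.
move=> /LM_1_row_eigenvector[z] kz ->.
have {kz} -> : z = 0 by apply: (mulfI kq); apply: (mulfI k1); rewrite kz !mulr0.
by apply/rowP => -[[|[|[|[|[|[|i]]]]]] // ?]; rewrite !mxE //= mulr0.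
Qed.

End LMKernel.

(** * Fixed vectors and intertwiners with [TYM_3] *)

Section TYMIntertwiners.
Variables (R : idomainType) (t q : R).
Hypotheses (t0 : t != 0) (q0 : q != 0) (k1 : 1 - t != 0) (kq : 1 + q ^+ 2 != 0).
Hypothesis ktq : 1 - q ^+ 4 * t ^+ 2 != 0.

(* [x] and [y] are the images of [e_1] and [e_3]; since [sigma_1 e_1 = t e_2]
   and [sigma_2 e_3 = e_2] in [TYM_3], they satisfy the last equation. *)
Lemma LM_TYM_col (x y : 'cV[R]_6) : 1 - q ^+ 2 * t != 0 ->
    LM_2 t q *m x = x -> LM_1 t q *m y = y ->
    t *: (LM_2 t q *m y) = LM_1 t q *m x ->
  x = 0.
Proof.
move=> k2.
have [[|x1 [|x2 [|x3 [|x4 [|x5 [|x6 []]]]]]] // _ ->] := col_ofP x.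
rewrite mul_mx_col_of => /col_of_inj/(_ erefl erefl)[] /=.
move=> e1 e2 e3 e4 e5 e6.
have x40 : x4 = 0 by apply: (@lincomb1 _ _ (- 1) _ _ _ e4 kq); ring.
have x50 : x5 = 0 by apply: (@lincomb2 _ _ (- 1) (q ^+ 2) _ _ _ _ _ e5 e6 ktq); ring.
have x60 : x6 = 0.
  by apply: (@lincomb2 _ _ (- 1) (q ^+ 2 * t ^+ 2) _ _ _ _ _ e6 e5 ktq); ring.
subst x4 x5 x6.
have x20 : x2 = 0 by apply: (@lincomb2 _ _ (- 1) (- 1) _ _ _ _ _ e2 e3 k1); ring.
have x30 : x3 = 0 by apply: (@lincomb2 _ _ (- 1) (- t) _ _ _ _ _ e3 e2 k1); ring.
(* Now [x] is [x1] times the first basis vector. At [c = 1] the eigenvector lemma makes [y] equal to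
   [f] times the last one. *)
subst x2 x3; rewrite -{2}[y]scale1r => /LM_1_col_eigenvector[] //; rewrite ?expr1n //.
move=> f _ ->; rewrite !mul_mx_col_of scale_col_of
  => /col_of_inj/(_ erefl erefl)[] /= _ f2 _ _ f5 _.
(* Coordinates 2 and 5 read t q^2 f = - q^2 t^2 x1 and - t q^2 f = t x1. Adding them eliminates f
   and leaves t (1 - q^2 t) x1 = 0. *)
have -> : x1 = 0.
  by apply: (@lincomb2 _ _ (- 1) (- 1) _ _ _ _ _ f2 f5 (mulf_neq0 t0 k2)); ring.
by apply/colP => -[[|[|[|[|[|[|i]]]]]] // ?]; rewrite !mxE.
Qed.

(* Dually, [x] and [y] are the pullbacks of the coordinate forms [e_1^*] and
   [e_3^*]; here [e_1^* sigma_1 = e_2^*] and [e_3^* sigma_2 = t e_2^*]. *)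
Lemma LM_TYM_row (x y : 'rV[R]_6) : 1 - q ^+ 6 * t != 0 ->
    x *m LM_2 t q = x -> y *m LM_1 t q = y ->
    y *m LM_2 t q = t *: (x *m LM_1 t q) ->
  x = 0.
Proof.
move=> k6.
have [[|x1 [|x2 [|x3 [|x4 [|x5 [|x6 []]]]]]] // _ ->] := row_ofP x.
rewrite mul_row_of_mx => /row_of_inj/(_ erefl erefl)[] /=.
move=> e1 e2 e3 e4 e5 e6.
have x20 : x2 = 0 by apply: (@lincomb2 _ _ (- 1) (- t) _ _ _ _ _ e2 e3 k1); ring.
have x30 : x3 = 0 by apply: (@lincomb2 _ _ (- 1) (- 1) _ _ _ _ _ e3 e2 k1); ring.
subst x2 x3.
have x50 : x5 = 0.
  by apply: (@lincomb2 _ _ (- 1) (q ^+ 2 * t ^+ 2) _ _ _ _ _ e5 e6 ktq); ring.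
have x60 : x6 = 0 by apply: (@lincomb2 _ _ (- 1) (q ^+ 2) _ _ _ _ _ e6 e5 ktq); ring.
subst x5 x6; rewrite -{2}[y]scale1r => /LM_1_row_eigenvector[] //; rewrite ?expr1n //.
move=> z _ ->; rewrite !mul_row_of_mx scale_row_of
  => /row_of_inj/(_ erefl erefl)[] /= _ f2 _ _ f5 _.
(* Coordinate 2 is t z = t (x4 - q^2 x1), and [e4] gives q^2 x1 = (1 + q^2) x4. Substituting the
   result in coordinate 5, - q^4 t^2 z = t x4, then leaves t (1 - q^6 t) x4 = 0. *)
have tz : t * z = - (t * q ^+ 2 * x4).
  apply/eqP; rewrite -subr_eq0; apply/eqP.
  by apply: (@lincomb2 _ 1 1 (- t) _ _ _ _ _ f2 e4 (oner_neq0 _)); ring.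
have x40 : x4 = 0.
  by apply: (@lincomb2 _ _ (- 1) (- (q ^+ 4 * t)) _ _ _ _ _ f5 tz (mulf_neq0 t0 k6)); ring.
subst x4.
have -> : x1 = 0 by apply: (@lincomb1 _ _ 1 _ _ _ e4 (expf_neq0 2 q0)); ring.
by apply/rowP => -[[|[|[|[|[|[|i]]]]]] // ?]; rewrite !mxE.
Qed.

End TYMIntertwiners.

(** * Explicit eigenvectors of the candidate representations *)

Section Eigenvectors.
Variable R : comUnitRingType.
Variables t q : R.

Ltac eigen := rewrite ?(mul_mx_col_of, scale_col_of, mul_row_of_mx, scale_row_of);
  congr col_of || congr row_of; rows_eq ltac:(ring).

Lemma redBur_1_eigenvector :
  redBur_1 t *m col_of 2 [:: 1; 0] = - t *: col_of 2 [:: 1; 0].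
Proof. eigen. Qed.

Lemma TYM_1_eigenvector :
  TYM_1 t *m col_of 3 [:: 0; 0; 1] = 1 *: col_of 3 [:: 0; 0; 1].
Proof. eigen. Qed.

Lemma TYM_2_eigenvector :
  TYM_2 t *m col_of 3 [:: 1; 0; 0] = col_of 3 [:: 1; 0; 0].
Proof. eigen. Qed.

Lemma TYM_col_e2 :
  t *: (TYM_2 t *m col_of 3 [:: 0; 0; 1]) = TYM_1 t *m col_of 3 [:: 1; 0; 0].
Proof. eigen. Qed.

Lemma TYM_1_row_eigenvector :
  row_of 3 [:: 0; 0; 1] *m TYM_1 t = row_of 3 [:: 0; 0; 1].
Proof. eigen. Qed.

Lemma TYM_2_row_eigenvector :
  row_of 3 [:: 1; 0; 0] *m TYM_2 t = row_of 3 [:: 1; 0; 0].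
Proof. eigen. Qed.

Lemma TYM_row_e2 :
  row_of 3 [:: 0; 0; 1] *m TYM_2 t = t *: (row_of 3 [:: 1; 0; 0] *m TYM_1 t).
Proof. eigen. Qed.

Lemma Bur_1_eigenvector :
  Bur_1 t *m col_of 3 [:: 1; - 1; 0] = - t *: col_of 3 [:: 1; - 1; 0].
Proof. eigen. Qed.

Lemma Bur_1_row_eigenvector :
  row_of 3 [:: 1; - t; 0] *m Bur_1 t = - t *: row_of 3 [:: 1; - t; 0].
Proof. eigen. Qed.

(** The block of [LKB_1] on the last two coordinates has eigenvalues 1 and - q. Solving for the
    first coordinate divides by 1 + q^2 t here and by 1 - q t for the eigenvalue - q, so both
    vectors are scaled by these denominators. *)
Lemma LKB_1_eigenvector_1 (v := col_of 3
    [:: q ^+ 2 * (1 - q) * t; q * (1 + q ^+ 2 * t); 1 + q ^+ 2 * t]) :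
  LKB_1 t q *m v = 1 *: v.
Proof. rewrite /v; eigen. Qed.

Lemma LKB_1_eigenvector_q
    (v := col_of 3 [:: - ((1 - q) * t); 1 - q * t; - (1 - q * t)]) :
  LKB_1 t q *m v = - q *: v.
Proof. rewrite /v; eigen. Qed.

Lemma LKB_1_row_eigenvector_q :
  row_of 3 [:: 0; 1; - q] *m LKB_1 t q = - q *: row_of 3 [:: 0; 1; - q].
Proof. eigen. Qed.

End Eigenvectors.

(** * Specialisation to [A] and exclusion of the candidates *)

Lemma map_mx_of_rows (R S : nzRingType) (f : {rmorphism R -> S}) n rows :
  map_mx f (mx_of_rows n rows) = mx_of_rows n [seq [seq f x | x <- r] | r <- rows].
Proof.
apply/matrixP => i j; rewrite !mxE.
have [ilt | ige] := ltnP i (size rows); last first.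
  by rewrite !(nth_default [::]) ?size_map // !nth_nil rmorph0.
rewrite (nth_map [::]) //; set r := nth [::] rows i.
have [jlt | jge] := ltnP j (size r); first by rewrite (nth_map 0).
by rewrite !nth_default ?size_map // rmorph0.
Qed.

Lemma base_changeE (R S : comNzRingType) n (f : {rmorphism R -> S})
  (rho : B3_repr R n) g : base_change f rho g = map_mx f (rho g).
Proof. by []. Qed.

Lemma LM_eta3_sigma1 : LM_eta3 sigma1 = LM_1 t q.
Proof. exact: repr_of_gens_sigma1. Qed.

Lemma LM_eta3_sigma2 : LM_eta3 sigma2 = LM_2 t q.
Proof. exact: repr_of_gens_sigma2. Qed.

Lemma LKB3_sigma1 : LKB3 sigma1 = LKB_1 t q.
Proof. exact: repr_of_gens_sigma1. Qed.

Lemma Bur3_sigma1 : base_change Zt_to_A Bur3 sigma1 = Bur_1 t.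
Proof.
rewrite base_changeE [Bur3 _]repr_of_gens_sigma1 map_mx_of_rows /=.
by rewrite rmorphB !(rmorph0, rmorph1).
Qed.

Lemma TYM3_sigma1 : base_change Zt_to_A TYM3 sigma1 = TYM_1 t.
Proof.
rewrite base_changeE [TYM3 _]repr_of_gens_sigma1 map_mx_of_rows /=.
by rewrite !(rmorph0, rmorph1).
Qed.

Lemma TYM3_sigma2 : base_change Zt_to_A TYM3 sigma2 = TYM_2 t.
Proof.
rewrite base_changeE [TYM3 _]repr_of_gens_sigma2 map_mx_of_rows /=.
by rewrite !(rmorph0, rmorph1).
Qed.

Lemma LM_eta3_not_eigenvalue c : c \in [:: - t; - q] ->
  [/\ c ^+ 2 - q ^+ 4 * t ^+ 2 != 0, c + q ^+ 2 != 0, c ^+ 2 - t != 0 &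
      c - 1 != 0].
Proof.
rewrite !inE => /orP[] /eqP ->; split.
- A_neq0 ((- T) ^+ 2 - Q ^+ 4 * T ^+ 2).
- A_neq0 (- T + Q ^+ 2).
- A_neq0 ((- T) ^+ 2 - T).
- A_neq0 (- T - 1).
- A_neq0 ((- Q) ^+ 2 - Q ^+ 4 * T ^+ 2).
- A_neq0 (- Q + Q ^+ 2).
- A_neq0 ((- Q) ^+ 2 - T).
- A_neq0 (- Q - 1).
Qed.

Lemma LM_eta3_col_regular c : c \in [:: - t; - q] ->
  forall w : 'cV_6, LM_eta3 sigma1 *m w = c *: w -> w = 0.
Proof.
rewrite LM_eta3_sigma1 => /LM_eta3_not_eigenvalue[ktq kq kt k1] w.
exact: (LM_1_col_regular ktq kq kt k1).
Qed.

Lemma LM_eta3_row_regular c : c \in [:: - t; - q] ->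
  forall w : 'rV_6, w *m LM_eta3 sigma1 = c *: w -> w = 0.
Proof.
rewrite LM_eta3_sigma1 => /LM_eta3_not_eigenvalue[ktq kq kt k1] w.
exact: (LM_1_row_regular ktq kq kt k1).
Qed.

(** Tensoring the reduced Burau eigenvector for [- c] with a vector fixed by [tau sigma1] gives the
    eigenvalue [- c], which [LM_eta3 sigma1] does not have. This covers all four tensor products. *)
Lemma LM_eta3_tensor n c (rho : B3_repr A 2) (tau : B3_repr A n) (w : 'cV_n) :
    c \in [:: t; q] -> rho sigma1 = redBur_1 c -> tau sigma1 *m w = 1 *: w ->
    w != 0 ->
  ~ isomorphic_repr (tensor_repr rho tau) LM_eta3.
Proof.
move=> ctq rhoE tauw w0 /isomorphic_subrepresentation sub.
have rhov : rho sigma1 *m col_of 2 [:: 1; 0] = - c *: col_of 2 [:: 1; 0].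
  by rewrite rhoE redBur_1_eigenvector.
have := tensor_eigenvector rhov tauw; rewrite mulr1 => eig.
have Nctq : - c \in [:: - t; - q] by move: ctq; rewrite !inE !eqr_opp.
have := subrepresentation_eigenvector sub eig (LM_eta3_col_regular Nctq).
by move=> /tensmx_eq0/(_ w0)/colP/(_ 0)/eqP; rewrite !mxE oner_eq0.
Qed.

Lemma col_of_neq0 (R : comNzRingType) n (s : seq R) (i : 'I_n) :
  s`_i != 0 -> col_of n s != 0.
Proof. by apply: contraNneq => /colP/(_ i); rewrite !mxE => ->. Qed.

Lemma TYM3_not_subrepresentation :
  ~ is_subrepresentation (base_change Zt_to_A TYM3) LM_eta3.
Proof.
move=> /subrepresentation_mx[F F_eqv F_inj].
have F1 := F_eqv sigma1; have F2 := F_eqv sigma2.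
rewrite TYM3_sigma1 LM_eta3_sigma1 in F1; rewrite TYM3_sigma2 LM_eta3_sigma2 in F2.
have /F_inj/colP/(_ 0)/eqP : F *m col_of 3 [:: 1; 0; 0] = 0.
  apply: (@LM_TYM_col _ t q _ _ _ _ _ (F *m col_of 3 [:: 0; 0; 1])).
  - A_neq0 T.
  - A_neq0 (1 - T).
  - A_neq0 (1 + Q ^+ 2).
  - A_neq0 (1 - Q ^+ 4 * T ^+ 2).
  - A_neq0 (1 - Q ^+ 2 * T).
  - by rewrite mulmxA -F2 -mulmxA TYM_2_eigenvector.
  - by rewrite mulmxA -F1 -mulmxA TYM_1_eigenvector scale1r.
  - by rewrite !mulmxA -F1 -F2 -!mulmxA -TYM_col_e2 scalemxAr.
by rewrite !mxE oner_eq0.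
Qed.

Lemma TYM3_not_quotient : ~ is_quotient (base_change Zt_to_A TYM3) LM_eta3.
Proof.
move=> /quotient_mx[F F_eqv F_inj].
have F1 := F_eqv sigma1; have F2 := F_eqv sigma2.
rewrite TYM3_sigma1 LM_eta3_sigma1 in F1; rewrite TYM3_sigma2 LM_eta3_sigma2 in F2.
have /F_inj/rowP/(_ 0)/eqP : row_of 3 [:: 1; 0; 0] *m F = 0.
  apply: (@LM_TYM_row _ t q _ _ _ _ _ (row_of 3 [:: 0; 0; 1] *m F)).
  - A_neq0 T.
  - A_neq0 Q.
  - A_neq0 (1 - T).
  - A_neq0 (1 - Q ^+ 4 * T ^+ 2).
  - A_neq0 (1 - Q ^+ 6 * T).
  - by rewrite -mulmxA -F2 mulmxA TYM_2_row_eigenvector.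
  - by rewrite -mulmxA -F1 mulmxA TYM_1_row_eigenvector.
  - by rewrite -!mulmxA -F1 -F2 !mulmxA TYM_row_e2 scalemxAl.
by rewrite !mxE oner_eq0.
Qed.

Theorem proposition5p12 :
  ((~ is_subrepresentation (base_change Zt_to_A Bur3) LM_eta3 /\
    ~ is_quotient (base_change Zt_to_A Bur3) LM_eta3) /\
   (~ is_subrepresentation (base_change Zt_to_A TYM3) LM_eta3 /\
    ~ is_quotient (base_change Zt_to_A TYM3) LM_eta3) /\
   (~ is_subrepresentation LKB3 LM_eta3 /\
    ~ is_quotient LKB3 LM_eta3)) /\
  (~ isomorphic_repr (tensor_repr redBur3_t TYM3_q) LM_eta3 /\
   ~ isomorphic_repr (tensor_repr redBur3_q TYM3_t) LM_eta3 /\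
   ~ isomorphic_repr (tensor_repr redBur3_t LKB3) LM_eta3 /\
   ~ isomorphic_repr (tensor_repr redBur3_q LKB3) LM_eta3).
Proof.
have tP : - t \in [:: - t; - q] by rewrite mem_head.
have qP : - q \in [:: - t; - q] by rewrite !inE eqxx orbT.
have tP' : t \in [:: t; q] by rewrite mem_head.
have qP' : q \in [:: t; q] by rewrite !inE eqxx orbT.
have e3_neq0 : col_of 3 [:: 0; 0; 1 : A] != 0.
  by apply: (@col_of_neq0 _ _ _ ord_max); rewrite oner_eq0.
have LKB_eig := LKB_1_eigenvector_1 t q; rewrite -LKB3_sigma1 in LKB_eig.
have LKB_neq0 : col_of 3 [:: q ^+ 2 * (1 - q) * t; q * (1 + q ^+ 2 * t);
    1 + q ^+ 2 * t] != 0.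
  by apply: (@col_of_neq0 _ _ _ ord_max) => /=; A_neq0 (1 + Q ^+ 2 * T).
split; [split; [|split; [|]]; split => h | split; [|split; [|split]]].
- have eig := Bur_1_eigenvector t; rewrite -Bur3_sigma1 in eig.
  have := subrepresentation_eigenvector h eig (LM_eta3_col_regular tP).
  by move=> /colP/(_ 0)/eqP; rewrite !mxE oner_eq0.
- have eig := Bur_1_row_eigenvector t; rewrite -Bur3_sigma1 in eig.
  have := quotient_eigenvector h eig (LM_eta3_row_regular tP).
  by move=> /rowP/(_ 0)/eqP; rewrite !mxE oner_eq0.
- exact: TYM3_not_subrepresentation h.
- exact: TYM3_not_quotient h.
- have eig := LKB_1_eigenvector_q t q; rewrite -LKB3_sigma1 in eig.
  have := subrepresentation_eigenvector h eig (LM_eta3_col_regular qP).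
  (* The eigenvector is nonzero because its middle coordinate is 1 - q t. *)
  apply/eqP/(@col_of_neq0 _ _ _ (lift ord0 ord0)) => /=; A_neq0 (1 - Q * T).
- have eig := LKB_1_row_eigenvector_q t q; rewrite -LKB3_sigma1 in eig.
  have := quotient_eigenvector h eig (LM_eta3_row_regular qP).
  by move=> /rowP/(_ (lift ord0 ord0))/eqP; rewrite !mxE oner_eq0.
(* [TYM_3] and its variant share the matrix of [sigma1], so the same fixed vector e_3 serves
   here. *)
- apply: LM_eta3_tensor tP' (repr_of_gens_sigma1 _ _ _) _ e3_neq0.
  by rewrite [TYM3_q _]repr_of_gens_sigma1 TYM_1_eigenvector.
- apply: LM_eta3_tensor qP' (repr_of_gens_sigma1 _ _ _) _ e3_neq0.
  by rewrite [TYM3_t _]repr_of_gens_sigma1 TYM_1_eigenvector.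
- exact: LM_eta3_tensor tP' (repr_of_gens_sigma1 _ _ _) LKB_eig LKB_neq0.
- exact: LM_eta3_tensor qP' (repr_of_gens_sigma1 _ _ _) LKB_eig LKB_neq0.
Qed.
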